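(* Let $m,n$ be positive integers and $r$ an integer with $\gcd(m,n)=\gcd(m,r-1)=1$ and $r^n\equiv 1\pmod m$. Let $G=\mathrm{ZM}(m,n,r)=\langle a,b\mid a^m=b^n=1,\ b^{-1}ab=a^r\rangle$ and let $d=o_m(r)$ be the multiplicative order of $r$ modulo $m$. Then $$k(G)=\frac{n}{md}\sum_{\alpha=0}^{d-1}\sum_{\beta=0}^{m-1}\frac{\gcd(m,r^{\alpha}-1)}{o_{e(\alpha,\beta)}(r)},\qquad\text{where } e(\alpha,\beta)=\frac{\gcd(m,r^{\alpha}-1)}{\gcd(m,r^{\alpha}-1,\beta)}.$$
   Context: For a finite group $G$, $k(G)$ denotes the number of conjugacy classes of elements of $G$. For a positive integer $t$ and an integer $r$ coprime to $t$, $o_t(r)=\min\{k\ge 1 : r^k\equiv 1 \pmod t\}$ is the multiplicative order of $r$ modulo $t$ (so $o_1(r)=1$). The convention $\gcd(t,0)=t$ is used. *)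

(* Defs.v *)
From mathcomp Require Import all_boot all_order all_algebra all_fingroup cyclic.

Set Implicit Arguments.
Unset Strict Implicit.
Unset Printing Implicit Defensive.

Import Order.TTheory GRing.Theory Num.Theory.

Definition is_mulexp (t : nat) (r : int) (k : nat) : bool :=
  (0 < k) && (r ^+ k == 1 %[mod t])%Z.

Lemma mulexp_exists (t : nat) (r : int) :
  (0 < t) && coprimez t r -> exists k, is_mulexp t r k.
Proof.
case/andP=> t0 cop; exists (totient t); rewrite /is_mulexp totient_gt0 t0 /=.
have t0z : Posz t != 0%R by rewrite -lt0n.
have [u Hu] : exists u : nat, (r %% t)%Z = u.
  by exists `|(r %% t)%Z|%N; rewrite gez0_abs // modz_ge0.
have copu : coprime u t.
  by move: cop; rewrite /coprimez -gcdz_modr Hu gcdzC.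
by rewrite -modzXm Hu -rmorphXn /= !modz_nat (Euler_exp_totient copu).
Qed.

(* The multiplicative order of r modulo t. The value 0 is a dummy, taken only
   when t = 0 or r is not coprime to t. *)
Definition mulord (t : nat) (r : int) : nat :=
  match @idP ((0 < t) && coprimez t r) with
  | ReflectT ok => ex_minn (mulexp_exists ok)
  | ReflectF _ => 0
  end.

Lemma mulordP (t : nat) (r : int) : 0 < t -> coprimez t r ->
  is_mulexp t r (mulord t r) /\
  (forall k, is_mulexp t r k -> mulord t r <= k).
Proof.
move=> t0 cop; rewrite /mulord; case: {-}_ / idP => [ok|].
  by case: ex_minnP => k Pk kmin.
by rewrite t0 cop.
Qed.

(* Integer powers in group presentations; the library has natural exponents. *)
Definition Expz (x : Presentation.term) (z : int) : Presentation.term :=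
  match z with
  | Posz k => Presentation.Exp x k
  | Negz k => Presentation.Inv (Presentation.Exp x k.+1)
  end.

Notation "x ^% z" := (Expz x z)
  (in custom group_presentation at level 29, z constr at level 28).

(* Main.v *)
Require Import Defs.
From mathcomp Require Import all_boot all_order all_algebra all_fingroup.
From mathcomp Require Import cyclic.

(** Every element of G is uniquely y^i x^j with i < n and j < m; uniqueness
    amounts to |G| = mn, for which an explicit model of the presentation is
    needed. Let g = gcd(m, r^i - 1). Conjugation by x moves j inside its coset
    modulo g, and conjugation by y multiplies j by r, so the class of y^i x^j
    has o_{e(i,j)}(r) * m / g elements. Summing 1 / |class| over G counts the
    classes, and the summand depends on i only modulo d, which divides n. *)

Set Implicit Arguments.
Unset Strict Implicit.
Unset Printing Implicit Defensive.

Import GRing.Theory Num.Theory GroupScope.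

Local Open Scope nat_scope.

(** * Preliminaries: congruences, multiplicative orders and class counting *)

Lemma eqn_mod_mull_cancel (e b u v : nat) :
  coprime e b -> (b * u == b * v %[mod e]) = (u == v %[mod e]).
Proof.
move=> cop; wlog le_vu: u v / v <= u.
  move=> W; case/orP: (leq_total v u) => /W // E.
  by rewrite eq_sym E eq_sym.
by rewrite !eqn_mod_dvd ?leq_mul2l ?le_vu ?orbT // -mulnBr Gauss_dvdr.
Qed.

(** Dividing by c = gcd(g, b) leaves b / c prime to the new modulus. This is where the moduli e(i,
    j) come from: they decide when two multiples of j agree modulo g. *)
Lemma eqn_mod_mull_gcd (g b u v : nat) : 0 < g ->
  (b * u == b * v %[mod g]) = (u == v %[mod g %/ gcdn g b]).
Proof.
move=> g0; set c := gcdn g b; set e := g %/ c.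
have c0 : 0 < c by rewrite gcdn_gt0 g0.
have Eg : g = c * e by rewrite mulnC divnK ?dvdn_gcdl.
have Eb : b = c * (b %/ c) by rewrite mulnC divnK ?dvdn_gcdr.
have cop : coprime e (b %/ c).
  by rewrite /coprime -(eqn_pmul2l c0) muln_gcdr -Eg -Eb muln1.
by rewrite {1 2}Eb Eg -!mulnA -!muln_modr eqn_pmul2l // eqn_mod_mull_cancel.
Qed.

Lemma eqn_mod_add_mul (m g a b : nat) :
  0 < m -> g %| m -> a = b %[mod g] ->
  exists2 l, l < m %/ g & a = b + g * l %[mod m].
Proof.
move=> m0 gm Eab; have g0 := dvdn_gt0 m0 gm.
have Em : m = g * (m %/ g) by rewrite mulnC divnK.
(* Since [g] divides [m], [b * m.-1] represents -b modulo [g], which avoids truncated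
   subtraction. *)
have /dvdnP[l El] : g %| a + b * m.-1.
  rewrite /dvdn -modnDml Eab modnDml -mulnS prednK //.
  by apply: dvdn_mull.
exists (l %% (m %/ g)); first by rewrite ltn_mod divn_gt0 // dvdn_leq.
by rewrite muln_modr -Em modnDmr mulnC -El addnCA -mulnS prednK // addnC modnMDl.
Qed.

(** By minimality of the order, s^i is 1 only when the order divides i; cancelling the invertible
    s^l reduces a comparison of two powers to this case. The natural number s replaces r so that it
    can serve in exponents of group elements. *)
Lemma mulord_expn (t : nat) (r : int) (s : nat) :
  0 < t -> coprime t s -> (r = s %[mod t])%Z ->
  0 < mulord t r /\
  forall k l, (s ^ k == s ^ l %[mod t]) = (k == l %[mod mulord t r]).
Proof.
move=> t0 cop Ers.
have copr : coprimez t r.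
  by rewrite /coprimez -gcdz_modr Ers gcdz_modr.
have [] := mulordP t0 copr; set o := mulord t r => Po omin.
have mulexpE k : is_mulexp t r k = (0 < k) && (s ^ k == 1 %[mod t]).
  rewrite /is_mulexp -modzXm Ers modzXm.
  by rewrite -rmorphXn /= !modz_nat natrXE.
move: Po; rewrite mulexpE => /andP[o0 /eqP so]; split=> // k l.
have s_dvd i : (s ^ i == 1 %[mod t]) = (o %| i).
  have -> : s ^ i = s ^ (i %% o) %[mod t].
    rewrite {1}(divn_eq i o) expnD (mulnC (i %/ o)) expnM.
    by rewrite -modnMml -modnXm so modnXm exp1n modnMml mul1n.
  rewrite /dvdn; have [->|i0] := posnP (i %% o); first by rewrite expn0 !eqxx.
  apply/negP => si.
  have := omin (i %% o); rewrite mulexpE i0 si => /(_ isT).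
  by rewrite leqNgt ltn_mod o0.
wlog le_lk: k l / l <= k.
  move=> W; case/orP: (leq_total l k) => /W // E.
  by rewrite eq_sym E eq_sym.
rewrite -[s ^ l in LHS]muln1 -{1}(subnKC le_lk) expnD eqn_mod_mull_cancel.
  by rewrite s_dvd eqn_mod_dvd.
by rewrite coprimeXr.
Qed.

(** The reciprocals over one class add up to 1. *)
Lemma classes_card_sum (gT : finGroupType) (G : {group gT}) :
  (#|classes G|%:R = \sum_(z in G) (#|z ^: G|%:R)^-1 :> rat)%R.
Proof.
rewrite [RHS](set_partition_big _ (classes_partition G)) /=.
rewrite -sum1_card natr_sum; apply: eq_bigr => _ /imsetP[z Gz ->].
rewrite (eq_bigr (fun=> (#|z ^: G|%:R)^-1)%R) => [|w /class_eqP-> //].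
rewrite sumr_const -[RHS]mulr_natr mulVf // pnatr_eq0 -lt0n.
by apply/card_gt0P; exists z; apply: class_refl.
Qed.

(** * Normal form and class sizes under the relations of the presentation *)

Section MetacyclicPresentation.

Variables (gT : finGroupType) (G : {group gT}) (x y : gT) (m n s : nat).
Hypotheses (m0 : 0 < m) (n0 : 0 < n).
Hypotheses (xm : x ^+ m = 1%g) (yn : y ^+ n = 1%g) (xy : (x ^ y = x ^+ s)%g).
Hypothesis defG : G :=: <[x]> <*> <[y]>.
Hypothesis oG : m * n <= #|G|.

Let elt (p : 'I_n * 'I_m) := (y ^+ p.1 * x ^+ p.2)%g.

Lemma metacyclic_elt_inG i j : (y ^+ i * x ^+ j)%g \in G.
Proof.
by rewrite defG groupM // groupX // mem_gen // inE cycle_id ?orbT.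
Qed.

Lemma metacyclic_eltP w :
  reflect (exists i j, w = y ^+ i * x ^+ j)%g (w \in G).
Proof.
apply: (iffP idP) => [|[i [j ->]]]; last exact: metacyclic_elt_inG.
have nxy : <[y]> \subset 'N(<[x]>) by rewrite norms_cycle xy mem_cycle.
rewrite defG joingC norm_joinEl // => /mulsgP[_ _ /cycleP[i ->] /cycleP[j ->]].
by exists i, j.
Qed.

Lemma metacyclic_elt_imset : elt @: setT = G.
Proof.
apply/setP=> w; apply/imsetP/metacyclic_eltP => [[[i j] _ ->]|[i [j ->]]].
  by exists i, j.
exists (Ordinal (ltn_pmod i n0), Ordinal (ltn_pmod j m0)) => //.
by rewrite /elt /= !expg_mod.
Qed.

(** A set of size mn maps onto G, and [oG] bounds |G| below by mn, so the surjection is a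
    bijection. *)
Lemma metacyclic_elt_inj : injective elt.
Proof.
have /imset_injP inj : #|elt @: setT| == #|[set: 'I_n * 'I_m]|.
  rewrite eqn_leq leq_imset_card metacyclic_elt_imset.
  by rewrite cardsT card_prod !card_ord mulnC.
by move=> p q; apply: inj; rewrite inE.
Qed.

Lemma metacyclic_eq_expgr i j j' :
  (y ^+ i * x ^+ j == y ^+ i * x ^+ j')%g = (j == j' %[mod m]).
Proof.
rewrite (inj_eq (mulgI _)); apply/eqP/eqP => [E|E]; last first.
  by rewrite -(expg_mod j xm) E expg_mod.
have := @metacyclic_elt_inj (Ordinal n0, Ordinal (ltn_pmod j m0))
                            (Ordinal n0, Ordinal (ltn_pmod j' m0)).
by rewrite /elt /= !expg_mod // E => /(_ erefl)[].
Qed.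

(** Conjugation by y^k multiplies the exponent of x by s^k. Moving x^(-j) to the right past y^i
    turns it into x^(-j s^i), which combines with the final x^j. *)
Lemma metacyclic_conj i b k j : 0 < s ->
  ((y ^+ i * x ^+ b) ^ (y ^+ k * x ^+ j)
     = y ^+ i * x ^+ (b * s ^ k) * x ^- ((s ^ i - 1) * j))%g.
Proof.
move=> s0.
have conjx l c : ((x ^+ c) ^ (y ^+ l) = x ^+ (c * s ^ l))%g.
  elim: l => [|l IH]; first by rewrite conjg1 muln1.
  by rewrite expgSr conjgM IH conjXg xy -expgM mulnC -mulnA expnSr.
have conjy : ((y ^+ i) ^ (y ^+ k) = y ^+ i)%g.
  by rewrite conjgE -expgD addnC expgD mulKg.
rewrite conjgM (conjMg (y ^+ i)) conjx conjy conjgE.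
have Exj : ((x ^- j) ^ (y ^+ i) = x ^- (j * s ^ i))%g by rewrite conjVg conjx.
rewrite !mulgA (conjgC (x ^- j)) Exj -!mulgA; congr (_ * _)%g.
have Es : j * s ^ i = (s ^ i - 1) * j + j.
  by rewrite -[X in _ + X]mul1n -mulnDl subnK ?expn_gt0 ?s0 // mulnC.
apply: (mulgI (x ^+ (j * s ^ i))%g).
rewrite mulKVg mulgA -!expgD Es -addnA.
by rewrite [X in _ = (x ^+ X * _)%g]addnC [in RHS]expgD mulgK addnC.
Qed.

(** Modulo m, the multiples of s^i - 1 are those of g, so the exponents of x in the class fill the
    residue classes of b s^k modulo g. The condition on o makes exactly o of these distinct, each
    with m / g residues modulo m. *)
Lemma metacyclic_card_class (i b o : nat) (g := gcdn m (s ^ i - 1)) :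
    0 < s -> 0 < o ->
    (forall k l, (s ^ k == s ^ l %[mod g %/ gcdn g b]) = (k == l %[mod o])) ->
  #|(y ^+ i * x ^+ b)%g ^: G| = o * (m %/ g).
Proof.
move=> s0 o0 s_mod_o; have gm : g %| m by apply: dvdn_gcdl.
have g0 := dvdn_gt0 m0 gm; have Em : m = g * (m %/ g) by rewrite mulnC divnK.
pose f (p : 'I_o * 'I_(m %/ g)) := (y ^+ i * x ^+ (b * s ^ p.1 + g * p.2))%g.
have f_inj : injective f.
  move=> [k j] [k' j'] /eqP; rewrite /f metacyclic_eq_expgr /= => E.
  (* Reducing the exponents modulo g removes the term in j and determines k modulo o. *)
  have Ek : k = k'.
    apply/val_inj/eqP; rewrite /= -(modn_small (ltn_ord k)).
    rewrite -[X in _ == X](modn_small (ltn_ord k')) -s_mod_o.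
    rewrite -eqn_mod_mull_gcd //.
    have /(congr1 (modn^~ g)) := eqP E.
    by rewrite /= !modn_dvdm // !(addnC (b * _)) !(mulnC g) !modnMDl => ->.
  have : g * j == g * j' %[mod g * (m %/ g)].
    by rewrite -Em -(eqn_modDl (b * s ^ k)) {2}Ek.
  by rewrite -!muln_modr eqn_pmul2l // !modn_small // Ek => /eqP Ej;
    congr (_, _); apply: val_inj.
(* The coefficient satisfies a (s^i - 1) = -g modulo m, so conjugating by x^(a j) adds g j to the
   exponent. *)
have [a _ /dvdnP[q Ea]] := Bezoutl (s ^ i - 1) m0.
rewrite -[RHS](_ : #|f @: setT| = _); last first.
  by rewrite card_imset // cardsT card_prod !card_ord.
apply: eq_card => w; apply/imsetP/imsetP => [[_ /metacyclic_eltP[k [j ->]] ->]|].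
  (* Multiplication by [m.-1] negates exponents modulo m, so that [metacyclic_eq_expgr] applies to
     inverses. *)
  have xV c : (x ^- c = x ^+ (c * m.-1))%g.
    apply/eqP; rewrite eq_invg_mul -expgD -mulnS prednK //.
    by rewrite mulnC expgM xm expg1n.
  have Eb : b * s ^ k + (s ^ i - 1) * j * m.-1 = b * s ^ (k %% o) %[mod g].
    have /dvdnP[t ->] : g %| s ^ i - 1 by apply: dvdn_gcdr.
    rewrite -[X in _ + X]mulnA (mulnAC t) addnC modnMDl.
    by apply/eqP; rewrite eqn_mod_mull_gcd // s_mod_o modn_mod.
  have [l lt_l El] := eqn_mod_add_mul m0 gm Eb.
  exists (Ordinal (ltn_pmod k o0), Ordinal lt_l) => //.
  rewrite metacyclic_conj // xV -mulgA -expgD; apply/eqP.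
  by rewrite metacyclic_eq_expgr; apply/eqP.
case=> [[k j] _ ->]; exists (y ^+ k * x ^+ (a * j))%g.
  exact: metacyclic_elt_inG.
rewrite metacyclic_conj // /f /=; rewrite -mulgA; congr (_ * _)%g.
rewrite expgD; congr (_ * _)%g; apply/eqP; rewrite eq_sym eq_invg_mul -expgD.
by rewrite mulnA -mulnDl addnC (mulnC (_ - 1)) Ea mulnAC mulnC expgM xm expg1n.
Qed.

Lemma metacyclic_sum (F : gT -> rat) :
  (\sum_(z in G) F z
     = \sum_(0 <= i < n) \sum_(0 <= j < m) F (y ^+ i * x ^+ j)%g)%R.
Proof.
rewrite -metacyclic_elt_imset big_imset /=; last first.
  by move=> p q _ _; apply: metacyclic_elt_inj.
under eq_bigl do rewrite inE.
rewrite -(pair_bigA _ (fun (i : 'I_n) (j : 'I_m) => F (y ^+ i * x ^+ j)%g)) /=.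
by rewrite big_mkord; apply: eq_bigr => i _; rewrite big_mkord.
Qed.

End MetacyclicPresentation.

(** * A concrete model and the order of the presented group *)

(* The semidirect product acting regularly on itself: the pair (i, j) stands
   for b ^ j * a ^ i, and right translation by a and b gives the permutations. *)
Lemma metacyclic_model (m n s : nat) : 0 < m -> 0 < n -> s ^ n = 1 %[mod m] ->
  exists (rT : finGroupType) (a b : rT),
    [/\ #[a]%g = m, #[b]%g = n & (a ^ b = a ^+ s)%g].
Proof.
move=> m0 n0 sn; pose T := ('I_m * 'I_n)%type.
pose M i : 'I_m := Ordinal (ltn_pmod i m0).
pose N j : 'I_n := Ordinal (ltn_pmod j n0).
have Mid (i : 'I_m) : M i = i by apply/val_inj/modn_small.
have Nid (j : 'I_n) : N j = j by apply/val_inj/modn_small.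
pose fa (p : T) : T := (M (p.1 + 1), p.2).
pose fb (p : T) : T := (M (s * p.1), N (p.2 + 1)).
have fa_iter k p : iter k fa p = (M (p.1 + k), p.2).
  elim: k => [|k IH]; first by rewrite addn0 Mid -surjective_pairing.
  rewrite iterS IH /fa; congr (_, _); apply: val_inj.
  by rewrite /= modnDml addn1 addnS.
have fb_iter k p : iter k fb p = (M (s ^ k * p.1), N (p.2 + k)).
  elim: k => [|k IH]; first by rewrite addn0 mul1n Mid Nid -surjective_pairing.
  rewrite iterS IH /fb; congr (_, _); apply: val_inj => /=.
    by rewrite modnMmr mulnA expnS.
  by rewrite modnDml addn1 addnS.
have fam p : iter m fa p = p.
  rewrite fa_iter (_ : M _ = p.1) -?surjective_pairing //; apply: val_inj.
  by rewrite /= modnDr modn_small.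
have fbn p : iter n fb p = p.
  rewrite fb_iter (_ : M _ = p.1) 1?(_ : N _ = p.2) -?surjective_pairing //.
    by apply: val_inj; rewrite /= modnDr modn_small.
  by apply: val_inj; rewrite /= -modnMml sn modnMml mul1n modn_small.
have fa_inj : injective fa.
  by apply: (can_inj (g := iter m.-1 fa)) => p; rewrite -iterSr prednK.
have fb_inj : injective fb.
  by apply: (can_inj (g := iter n.-1 fb)) => p; rewrite -iterSr prednK.
have ea : (fun p => perm fa_inj p) =1 fa by move=> p; rewrite permE.
have eb : (fun p => perm fb_inj p) =1 fb by move=> p; rewrite permE.
(* The orbit of [p0] has length m under the first permutation and n under the second, which bounds
   both orders from below. *)
pose p0 : T := (M 0, N 0).
exists {perm T}, (perm fa_inj), (perm fb_inj); split.
- apply/eqP; rewrite eqn_dvd order_dvdn; apply/andP; split.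
    by apply/eqP/permP => p; rewrite permX (eq_iter ea) fam perm1.
  have /permP/(_ p0) := expg_order (perm fa_inj).
  by rewrite permX (eq_iter ea) fa_iter perm1 => /(congr1 (val \o fst))/= /eqP;
    rewrite mod0n.
- apply/eqP; rewrite eqn_dvd order_dvdn; apply/andP; split.
    by apply/eqP/permP => p; rewrite permX (eq_iter eb) fbn perm1.
  have /permP/(_ p0) := expg_order (perm fb_inj).
  by rewrite permX (eq_iter eb) fb_iter perm1 => /(congr1 (val \o snd))/= /eqP;
    rewrite mod0n.
(* The relation is checked in the inverse-free form a b = b a^s. *)
rewrite conjgE; apply: (canLR (mulKg _)); apply/permP => p.
rewrite !permM permX (eq_iter ea) !permE fa_iter; congr (_, _); apply: val_inj.
by rewrite /= modnDml modnMmr mulnDr muln1.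
Qed.

(** Trades the integer power of the presentation for a natural one. For r = -(k + 1), the congruence
    says that m divides k + 1 + s. *)
Lemma eval_Expz_mod (gT : finGroupType) (e : seq gT) t (m s : nat) (r : int) :
    (r = s %[mod m])%Z -> Presentation.eval e t ^+ m = 1%g ->
  Presentation.eval e (Expz t r) = (Presentation.eval e t ^+ s)%g.
Proof.
case: r => k Ers xm /=.
  move/eqP: Ers; rewrite !modz_nat eqz_nat => /eqP E.
  by rewrite -(expg_mod k xm) E expg_mod.
apply/eqP; rewrite eq_invg_mul -expgD -(expg_mod _ xm).
have /eqP : (Posz (k.+1 + s) = 0 %[mod m])%Z.
  by rewrite PoszD -modzDmr -Ers modzDmr NegzE subrr.
by rewrite !modz_nat eqz_nat mod0n => /eqP->.
Qed.

(** G maps onto the subgroup generated by the a and b of the model, whose order is divisible by the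
    coprime numbers m and n. The generators x and y exist because G satisfies its own
    presentation. *)
Lemma card_metacyclic_presentation (m n s : nat) (r : int)
    (gT : finGroupType) (G : {group gT}) :
    0 < m -> 0 < n -> coprime m n -> s ^ n = 1 %[mod m] -> (r = s %[mod m])%Z ->
    (G \isog Grp (a : b : (a ^+ m = b ^+ n = 1, a ^ b = a ^% r)))%g ->
  m * n <= #|G| /\ exists x y : gT,
    [/\ x ^+ m = 1, y ^+ n = 1, x ^ y = x ^+ s & G :=: <[x]> <*> <[y]>]%g.
Proof.
move=> m0 n0 cop sn Ers isoG.
split.
  have [rT [a [b [oa ob ab]]]] := metacyclic_model m0 n0 sn.
  have : (<[a]> <*> <[b]> \homg G)%g.
    rewrite isoG; apply/existsP; exists (a, b); rewrite /= !xpair_eqE eqxx /=.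
    rewrite -{1}oa -{1}ob !expg_order !eqxx /=.
    by rewrite ab (eval_Expz_mod Ers) //= -oa expg_order.
  move/leq_homg/(leq_trans _); apply.
  apply: dvdn_leq; first exact: cardG_gt0.
  rewrite Gauss_dvd // -{1}oa -ob; apply/andP; split; apply: order_dvdG.
    by rewrite mem_gen // inE cycle_id.
  by rewrite mem_gen // inE cycle_id orbT.
have /existsP[[x y] /= /eqP[defG xm yn xy]] := isoGrp_hom isoG.
by exists x, y; split=> //; rewrite xy (eval_Expz_mod Ers).
Qed.

(** * Passage from r to s and the final summation *)

Lemma gcdn_absz_modz (m : nat) (u v : int) : (u = v %[mod m])%Z ->
  gcdn m `|(u - 1)%R| = gcdn m `|(v - 1)%R|.
Proof.
move=> Euv; suff: gcdz m (u - 1)%R = gcdz m (v - 1)%R by case.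
by rewrite -gcdz_modr -modzDml Euv modzDml gcdz_modr.
Qed.

Lemma sum_nat_periodic (V : zmodType) (F : nat -> V) (d q : nat) :
    (forall i, F (i %% d) = F i) ->
  (\sum_(0 <= i < q * d) F i = (\sum_(0 <= i < d) F i) *+ q)%R.
Proof.
move=> Fd; rewrite big_nat_mul -[in RHS](subn0 q) -sumr_const_nat.
apply: eq_bigr => k _; rewrite -{1}[k * d]add0n big_addn mulSn addnK.
by apply: eq_bigr => i _; rewrite -Fd addnC modnMDl Fd.
Qed.

Theorem theorem2p5 (m n : nat) (r : int) (gT : finGroupType) (G : {group gT}) :
  (0 < m)%N -> (0 < n)%N ->
  coprime m n -> coprimez m (r - 1)%R ->
  (r ^+ n = 1 %[mod m])%Z ->
  (G \isog Grp (a : b : (a ^+ m = b ^+ n = 1, a ^ b = a ^% r)))%g ->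
  let d := mulord m r in
  let g (alpha : nat) := gcdn m `|(r ^+ alpha - 1)%R|%N in
  let e (alpha beta : nat) := (g alpha %/ gcdn (g alpha) beta)%N in
  (#|classes G|%:R = n%:R / (m%:R * d%:R) *
     \sum_(0 <= alpha < d) \sum_(0 <= beta < m)
        (g alpha)%:R / (mulord (e alpha beta) r)%:R :> rat)%R.
Proof.
move=> m0 n0 cop _ rn isoG d g e.
(* Adding m keeps s positive when m = 1, so that s ^ i - 1 is never truncated. *)
pose s := `|(r %% m)%Z| + m.
have Ers : (r = s %[mod m])%Z.
  by rewrite PoszD modzDr gez0_abs ?modz_ge0 ?modz_mod -?lt0n.
have s0 : 0 < s by rewrite addn_gt0 m0 orbT.
have rXs k : (r ^+ k = Posz (s ^ k) %[mod m])%Z.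
  by rewrite -modzXm Ers modzXm -rmorphXn /= natrXE.
have sn : s ^ n = 1 %[mod m].
  move: rn; rewrite rXs -[1%R]/(Posz 1) !modz_nat => /eqP.
  by rewrite eqz_nat => /eqP.
have cop_ms : coprime m s.
  by rewrite -(coprime_pexpr _ _ n0) -coprime_modr sn coprime_modr coprimen1.
have [d0 s_mod_d] := mulord_expn m0 cop_ms Ers.
have [oG [x [y [xm yn xy defG]]]] :=
  card_metacyclic_presentation m0 n0 cop sn Ers isoG.
have gE i : g i = gcdn m (s ^ i - 1).
  rewrite /g (gcdn_absz_modz (rXs i)) -[1%R]/(Posz 1).
  by rewrite subzn ?expn_gt0 ?s0.
(* Powers of s modulo m depend only on the exponent modulo d; this makes the summand periodic in
   i. *)
have g_mod i : g (i %% d) = g i.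
  apply: gcdn_absz_modz; rewrite !rXs !modz_nat; congr Posz.
  by apply/eqP; rewrite s_mod_d modn_mod.
have gm i : g i %| m by apply: dvdn_gcdl.
have em i j : e i j %| m.
  by apply: dvdn_trans (gm i); apply: dvdn_div; apply: dvdn_gcdl.
have class_card i j :
    #|(y ^+ i * x ^+ j)%g ^: G| = mulord (e i j) r * (m %/ g i).
  have e0 := dvdn_gt0 m0 (em i j).
  (* As e(i, j) divides m, s is also prime to e(i, j) and congruent to r modulo it. *)
  have [||o0 s_mod_o] := @mulord_expn (e i j) r s e0.
  - exact: coprime_dvdl (em i j) cop_ms.
  - apply/eqP; rewrite eqz_mod_dvd; apply: dvdz_trans (_ : (Posz m %| _)%Z).
      exact: em.
    by rewrite -eqz_mod_dvd; apply/eqP.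
  rewrite gE (metacyclic_card_class m0 n0 xm yn xy defG oG s0 o0) //.
  by rewrite -gE.
rewrite classes_card_sum (metacyclic_sum m0 n0 xm yn xy defG oG).
pose H i : rat := (\sum_(0 <= j < m) (g i)%:R / (mulord (e i j) r)%:R)%R.
(* With o the order of r modulo e(i, j), the reciprocal of the class size o (m / g) is (1 / m) (g /
   o). *)
rewrite (eq_bigr (fun i => m%:R^-1 * H i)%R) => [|i _]; last first.
  rewrite mulr_sumr; apply: eq_bigr => j _; rewrite class_card.
  have gi0 : ((g i)%:R != 0 :> rat)%R by rewrite pnatr_eq0 -lt0n (dvdn_gt0 m0).
  have -> : (m%:R = (m %/ g i)%:R * (g i)%:R :> rat)%R by rewrite -natrM divnK.
  by rewrite natrM !invfM -mulrA mulKf // mulrC.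
(* Here s^n = 1 = s^0 modulo m. The outer sum then consists of q = n / d equal periods. *)
have /dvdnP[q ->] : d %| n.
  by rewrite /dvdn -(mod0n d) -s_mod_d expn0; apply/eqP.
rewrite -mulr_sumr sum_nat_periodic => [|i]; last by rewrite /H /e g_mod.
rewrite natrM -mulf_div divff ?mulr1 ?pnatr_eq0 -?lt0n //.
by rewrite mulrnAr -[RHS]mulrA mulr_natl.
Qed.
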